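(* Let $\sigma$ be a functional signature disjoint from $\{-,\triangleright\}$. For every algebra $\mathfrak A$ in $\mathbf{AtRepAlg}(\sigma)$, the embedding $\eta_{\mathfrak A}\colon\mathfrak A\hookrightarrow(G'\circ F')(\mathfrak A)$, $a\mapsto\{([x],x)\mid x\in\mathrm{At}(\mathfrak A)\text{ and }x\le a\}$, is the compatible completion of $\mathfrak A$.
   Context: **Algebras.** A partial function from $X$ to $Y$ is a set $f\subseteq X\times Y$ such that $(x,y),(x,z)\in f$ implies $y=z$; $\mathrm{dom}(f)=\{x\mid \exists y\,(x,y)\in f\}$; $f\colon X\rightharpoonup Y$ denotes a partial function. An algebra of partial functions of the signature $\{-,\triangleright\}$ is a nonempty set of partial functions from some common set $X$ to some common set $Y$, closed under relative complement $f-g$ (set difference) and domain restriction $f\triangleright g=\{(x,y)\in g\mid x\in\mathrm{dom}(f)\}$. An abstract $\{-,\triangleright\}$-algebra (two binary operations) is representable if it is isomorphic to an algebra of partial functions. Put $a\cdot b:=a-(a-b)$; a representable algebra is partially ordered by $a\le b\iff a\cdot b=a$, with binary meet $\cdot$ and least element $0$. An atom is a minimal nonzero element; $\mathrm{At}(\mathfrak A)$ is the set of atoms; $\mathfrak A$ is atomic if every nonzero element is above an atom. Elements $a,b$ of a representable algebra are compatible if $a\triangleright b=b\triangleright a$; the algebra is compatibly complete if every subset of pairwise-compatible elements has a join. A subset $S$ of a poset is join dense if every element is the join of some subset of $S$. **Operators.** An $n$-ary operation $\Omega$ on $\mathfrak A$ is compatibility preserving if whenever $a_i,a_i'$ are compatible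 for all $i$, then $\Omega(a_1,\dots,a_n)$ and $\Omega(a_1',\dots,a_n')$ are compatible. It is completely additive if whenever $S\subseteq\mathfrak A$ has a supremum $\sum S$, then for every $i$ and all $a_j$ ($j\ne i$), $\Omega(a_1,\dots,a_{i-1},\sum S,a_{i+1},\dots,a_n)=\sum\{\Omega(a_1,\dots,a_{i-1},s,a_{i+1},\dots,a_n)\mid s\in S\}$. **The category $\mathbf{AtRepAlg}(\sigma)$.** Objects: algebras of signature $\{-,\triangleright\}\cup\sigma$ whose $\{-,\triangleright\}$-reduct is atomic and representable and in which the symbols of $\sigma$ are interpreted as compatibility preserving completely additive operations. Morphisms: complete homomorphisms of $(\{-,\triangleright\}\cup\sigma)$-algebras, where complete means preserving all existing joins. **Compatible completion.** For $\mathfrak A$ in $\mathbf{AtRepAlg}(\sigma)$, a compatible completion of $\mathfrak A$ is an embedding (injective homomorphism) $\iota\colon\mathfrak A\hookrightarrow\mathfrak C$ of $(\{-,\triangleright\}\cup\sigma)$-algebras such that $\mathfrak C$ is in $\mathbf{AtRepAlg}(\sigma)$ and compatibly complete, and $\iota[\mathfrak A]$ is join dense in $\mathfrak C$. (It is unique up to unique isomorphism, hence ''the''.) **The algebra $(G'\circ F')(\mathfrak A)$.** On $\mathfrak A$ let $a\preceq_{\mathfrak A}b\iff a\le b\triangleright a$ (a preorder), with induced equivalence relation $\sim_{\mathfrak A}$ and classes $[a]$. $F'(\mathfrak A)$ is the canonical projection $\pi_{\mathfrak A}\colon\mathrm{At}(\mathfrak A)\twoheadrightarrow\mathrm{At}(\mathfrak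 A)/{\sim_{\mathfrak A}}$ equipped with, for each $\Omega\in\sigma$ of arity $n$, the relation $R_\Omega x_1\dots x_{n+1}\iff\Omega(x_1,\dots,x_n)\ge x_{n+1}$ on $\mathrm{At}(\mathfrak A)$. For a surjection $\pi\colon X\twoheadrightarrow X_0$ equipped with relations, $G'(\pi)$ is the $\{-,\triangleright\}$-algebra of all partial functions $f\colon X_0\rightharpoonup X$ with $f\subseteq\pi^{-1}=\{(\pi(x),x)\mid x\in X\}$, equipped with, for each given $(n+1)$-ary relation $R$, the $n$-ary operation $\Omega_R$ given by $\Omega_R(f_1,\dots,f_n)=\{(\pi(x),x)\mid \exists x_1\in\mathrm{im}(f_1),\dots,x_n\in\mathrm{im}(f_n)\colon Rx_1\dots x_nx\}$. Thus $(G'\circ F')(\mathfrak A)$ has universe $\{f\colon\mathrm{At}(\mathfrak A)/{\sim_{\mathfrak A}}\rightharpoonup\mathrm{At}(\mathfrak A)\mid f\subseteq\pi_{\mathfrak A}^{-1}\}$, and each $\Omega\in\sigma$ is interpreted in it as $\Omega_{R_\Omega}$. *)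

(* Defs.v *)
From HB Require Import structures.
From mathcomp Require Import all_boot.
From mathcomp Require Import boolp classical_sets functions.

Set Implicit Arguments.
Unset Strict Implicit.
Unset Printing Implicit Defensive.

Local Open Scope classical_set_scope.

(* A partial function is a set of pairs; its domain and image are [f.`1] and
   [f.`2]. *)
Definition partial_function (X Y : Type) (f : set (X * Y)) : Prop :=
  forall x y z, f (x, y) -> f (x, z) -> y = z.

Definition pf_restr (X Y : Type) (f g : set (X * Y)) : set (X * Y) :=
  [set p | g p /\ f.`1 p.1].

Definition pf_algebra (X Y : Type) (B : set (set (X * Y))) : Prop :=
  [/\ B !=set0,
      forall f, B f -> partial_function f,
      forall f g, B f -> B g -> B (f `\` g)
    & forall f g, B f -> B g -> B (pf_restr f g)].

Record dr_algebra := DrAlgebra {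
  carrier :> Type;
  minus : carrier -> carrier -> carrier;
  restr : carrier -> carrier -> carrier  (* [restr a b] is [a |> b] *)
}.

Definition representable (A : dr_algebra) : Prop :=
  exists (X Y : Type) (B : set (set (X * Y))) (theta : A -> set (X * Y)),
    [/\ pf_algebra B,
        set_bij setT B theta,
        forall a b, theta (minus a b) = theta a `\` theta b
      & forall a b, theta (restr a b) = pf_restr (theta a) (theta b)].

Section Order.
Context {A : dr_algebra}.
Implicit Types (a b c : A) (S : set A).

Definition meet a b : A := minus a (minus a b).
Definition ple a b : Prop := meet a b = a.

Definition least a : Prop := forall b, ple a b.

Definition is_join S c : Prop :=
  (forall a, S a -> ple a c) /\ (forall b, (forall a, S a -> ple a b) -> ple c b).

Definition atom a : Prop :=
  ~ least a /\ (forall b, ~ least b -> ple b a -> b = a).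

Definition compatible a b : Prop := restr a b = restr b a.

Definition join_dense S : Prop :=
  forall c, exists2 T : set A, T `<=` S & is_join T c.

Definition preceq a b : Prop := ple a (restr b a).
Definition sim a b : Prop := preceq a b /\ preceq b a.

End Order.

Definition At (A : dr_algebra) : set A := [set a | atom a].
Arguments At : clear implicits.

Definition atomic (A : dr_algebra) : Prop :=
  forall a : A, ~ least a -> exists2 x, At A x & ple x a.

Definition compatibly_complete (A : dr_algebra) : Prop :=
  forall S : set A, (forall a b, S a -> S b -> compatible a b) ->
    exists c, is_join S c.

Record signature := Signature { symbol :> Type; arity : symbol -> nat }.

Record algebra (sigma : signature) := Algebra {
  reduct :> dr_algebra;
  interp : forall s : sigma, ('I_(arity s) -> reduct) -> reduct
}.

Section Operators.
Context {A : dr_algebra} {n : nat}.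
Implicit Type Omega : ('I_n -> A) -> A.

Definition compatibility_preserving Omega : Prop :=
  forall a a' : 'I_n -> A, (forall i, compatible (a i) (a' i)) ->
    compatible (Omega a) (Omega a').

(* [dfwith a s] is the tuple [a] with its [i]-th entry replaced by [s]. *)
Definition completely_additive Omega : Prop :=
  forall (S : set A) (c : A), is_join S c ->
  forall (i : 'I_n) (a : 'I_n -> A),
    is_join [set Omega (dfwith a (i := i) s) | s in S]
            (Omega (dfwith a (i := i) c)).

End Operators.

Definition AtRepAlg (sigma : signature) (A : algebra sigma) : Prop :=
  [/\ representable A, atomic A
    & forall s : sigma, compatibility_preserving (interp (a := A) (s := s)) /\
                        completely_additive (interp (a := A) (s := s))].

Definition homomorphism (sigma : signature) (A C : algebra sigma)
    (h : A -> C) : Prop :=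
  [/\ forall a b, h (minus a b) = minus (h a) (h b),
      forall a b, h (restr a b) = restr (h a) (h b)
    & forall (s : sigma) (a : 'I_(arity s) -> A),
        h (interp a) = interp (fun i => h (a i))].

Definition embedding (sigma : signature) (A C : algebra sigma)
    (h : A -> C) : Prop := homomorphism h /\ injective h.

Definition compatible_completion (sigma : signature) (A C : algebra sigma)
    (iota : A -> C) : Prop :=
  [/\ embedding iota, AtRepAlg C, compatibly_complete C
    & join_dense (range iota)].

Record rel_surjection (sigma : signature) := RelSurjection {
  total : Type;
  base : Type;
  proj : total -> base;
  proj_surj : forall y, exists x, proj x = y;
  rel_of : forall s : sigma, ('I_(arity s) -> total) -> total -> Prop
}.
Arguments rel_of {sigma} _ _ _ _.

Section Gprime.
Context {sigma : signature} (P : rel_surjection sigma).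

Definition inv_proj : set (base P * total P) :=
  [set (proj x, x) | x in [set: total P]].

Definition sections : set (set (base P * total P)) :=
  [set f | partial_function f /\ f `<=` inv_proj].

Definition Omega_rel (s : sigma) (f : 'I_(arity s) -> set (base P * total P)) :
    set (base P * total P) :=
  [set (proj x, x) | x in
    [set x | exists2 xs : 'I_(arity s) -> total P,
               (forall i, (f i).`2 (xs i)) & rel_of P s xs x]].

Lemma sections_minus (f g : set (base P * total P)) :
  sections f -> sections (f `\` g).
Proof.
move=> [pf sf]; split; first by move=> x y z [fy _] [fz _]; exact: pf fy fz.
by move=> p [fp _]; exact: sf.
Qed.

Lemma sections_restr (f g : set (base P * total P)) :
  sections g -> sections (pf_restr f g).
Proof.
move=> [pg sg]; split; first by move=> x y z [gy _] [gz _]; exact: pg gy gz.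
by move=> p [gp _]; exact: sg.
Qed.

(* For arbitrary relations, [Omega_rel f] may fail to be a partial function; for
   [P] of the form [Fprime A], see [Fprime_closed]. *)
Definition sections_closed : Prop :=
  forall (s : sigma) (f : 'I_(arity s) -> set (base P * total P)),
    (forall i, sections (f i)) -> sections (Omega_rel f).

Context (closedP : sections_closed).

Definition Gprime_reduct : dr_algebra := @DrAlgebra {f | sections f}
  (fun f g => exist _ _ (sections_minus (sval g) (svalP f)))
  (fun f g => exist _ _ (sections_restr (sval f) (svalP g))).

Definition Gprime : algebra sigma := @Algebra sigma Gprime_reduct
  (fun s f => exist _ _ (closedP (fun i => svalP (f i)))).

End Gprime.

Section Representation.
Context {A : dr_algebra} {X Y : Type} (theta : A -> set (X * Y)).
Context (theta_pf : forall a, partial_function (theta a)).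
Context (theta_inj : injective theta).
Context (theta_minus : forall a b, theta (minus a b) = theta a `\` theta b).
Context (theta_restr :
  forall a b, theta (restr a b) = pf_restr (theta a) (theta b)).

Lemma ple_rep (a b : A) : ple a b <-> theta a `<=` theta b.
Proof.
have E : theta (meet a b) = theta a `&` theta b.
  by rewrite /meet !theta_minus setDD.
split=> [ab|/setIidPl ab]; first by rewrite -[a]ab E; exact: subIsetr.
by apply: theta_inj; rewrite E.
Qed.

Lemma least_rep (a : A) : least a <-> theta a = set0.
Proof.
split=> [/(_ (minus a a))/ple_rep|a0 b]; last first.
  by apply/ple_rep; rewrite a0; exact: sub0set.
by rewrite theta_minus setDv subset0.
Qed.

Lemma atom_restr (x y : A) (u : X) : atom y ->
  (theta x).`1 u -> (theta y).`1 u -> preceq y x.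
Proof.
move=> [_ ymin] xu [v yv]; rewrite /preceq.
suff -> : restr x y = y by apply/ple_rep.
apply: ymin; last by apply/ple_rep; rewrite theta_restr => p [].
move=> /least_rep; rewrite theta_restr => /seteqP[/(_ (u, v)) xy _].
exact: xy.
Qed.

Lemma nsim_compatible (x y : A) : atom x -> atom y ->
  ~ sim x y -> compatible x y.
Proof.
move=> ax ay nxy; apply: theta_inj; rewrite !theta_restr.
by apply/seteqP; split=> -[u v] [/= p1 p2]; exfalso; apply: nxy; split;
  apply: atom_restr => //; eauto; exists v.
Qed.

Lemma preceq_rep (x y : A) :
  preceq x y <-> (theta x).`1 `<=` (theta y).`1.
Proof.
split=> [/ple_rep + u [v xv] | xy]; first by move=> /(_ _ xv); rewrite theta_restr => -[].
by apply/ple_rep => -[u v] xv; rewrite theta_restr; split=> //; apply: xy; exists v.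
Qed.

Lemma sim_eq (x y a b : A) : compatible a b -> ple x a -> ple y b ->
  sim x y -> x = y.
Proof.
move=> ab /ple_rep xa /ple_rep yb [xy yx].
have H u v : theta b (u, v) -> (theta a).`1 u -> theta a (u, v).
  move=> buv au; have : theta (restr a b) (u, v) by rewrite theta_restr.
  by rewrite ab theta_restr => -[].
apply: theta_inj; apply/seteqP; split=> -[u v] uv.
- have [w yw] : (theta y).`1 u by apply: (preceq_rep _ _).1 xy _ _; exists v.
  suff -> : v = w by [].
  apply: (theta_pf (xa _ uv)); apply: H; first exact: yb.
  by exists v; exact: xa.
- have [w xw] : (theta x).`1 u by apply: (preceq_rep _ _).1 yx _ _; exists v.
  suff -> : v = w by [].
  apply: (@theta_pf a u) (xa _ xw); apply: H; first exact: yb.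
  by exists w; exact: xa.
Qed.

End Representation.

Lemma rep_nsim_compatible (A : dr_algebra) (x y : A) : representable A ->
  At A x -> At A y -> ~ sim x y -> compatible x y.
Proof.
move=> [X [Y [B [th [[_ _ _ _] [_ thI _] thM thR]]]]].
by apply: (nsim_compatible (theta := th)) => // a b; apply: thI; rewrite inE.
Qed.

Lemma rep_sim_eq (A : dr_algebra) (x y a b : A) : representable A ->
  compatible a b -> ple x a -> ple y b -> sim x y -> x = y.
Proof.
move=> [X [Y [B [th [[_ Bpf _ _] [thB thI _] thM thR]]]]].
apply: (sim_eq (theta := th)) => // [c|c d].
  exact/Bpf/thB.
by apply: thI; rewrite inE.
Qed.

Lemma rep_preceq_refl (A : dr_algebra) (x : A) :
  representable A -> preceq x x.
Proof.
move=> [X [Y [B [th [_ [_ thI _] thM thR]]]]].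
by apply/(preceq_rep (theta := th)) => // a b; apply: thI; rewrite inE.
Qed.

Lemma rep_preceq_trans (A : dr_algebra) (x y z : A) :
  representable A -> preceq x y -> preceq y z -> preceq x z.
Proof.
move=> [X [Y [B [th [_ [_ thI _] thM thR]]]]].
have thI' : injective th by move=> a b; apply: thI; rewrite inE.
have P := preceq_rep thI' thM thR.
by move=> /P xy /P yz; apply/P; exact: subset_trans yz.
Qed.

Section Fprime.
Context {sigma : signature} (A : algebra sigma).

Definition sim_class (x : At A) : set (At A) :=
  [set y : At A | sim (val y) (val x)].

Definition At_quotient : Type := {C : set (At A) | range sim_class C}.

Definition class_of (x : At A) : At_quotient :=
  exist _ (sim_class x) (imageT sim_class x).

Lemma class_of_surj (c : At_quotient) : exists x, class_of x = c.
Proof. by case: c => C [x xT xC]; exists x; exact: eq_exist. Qed.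

Definition Fprime : rel_surjection sigma :=
  @RelSurjection sigma (At A) At_quotient class_of class_of_surj
    (fun s xs x => ple (val x) (interp (fun i => val (xs i)))).

Context (hA : AtRepAlg A).

Lemma class_of_eq (x y : At A) :
  class_of x = class_of y <-> sim (val x) (val y).
Proof.
have [Arep _ _] := hA; split=> [/(congr1 sval)/= xy|[xy yx]].
  suff : sim_class y x by [].
  by rewrite -xy; split; exact: rep_preceq_refl.
apply: eq_exist; apply/seteqP; split=> z [zx xz];
  by split; apply: rep_preceq_trans; eauto.
Qed.

Lemma Fprime_closed : sections_closed Fprime.
Proof.
have [Arep _ Aop] := hA.
move=> s f fS; split; last by move=> _ [x _ <-]; exists x.
move=> c y z [y' [ys fy Ry]] [yc <-] [z' [zs fz Rz]] [zc <-].
have /class_of_eq yz : class_of y' = class_of z' by rewrite yc zc.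
apply: val_inj; apply: (rep_sim_eq Arep _ Ry Rz yz).
apply: (Aop s).1 => i; have [fpf fi] := fS i.
have [p fp] := fy i; have [q fq] := fz i.
have [/class_of_eq yz'|nyz] := pselect (sim (val (ys i)) (val (zs i))).
  suff -> : ys i = zs i by [].
  case: (fi _ fp) => u _ [up uy]; case: (fi _ fq) => v _ [vq vz].
  have pq : p = q by rewrite -up -vq uy vz.
  by apply: (fpf p) => //; rewrite pq.
by apply: (rep_nsim_compatible Arep _ _ nyz); exact: (set_mem (valP _)).
Qed.

Lemma eta_section (a : A) : sections (P := Fprime)
  [set (class_of x, x) | x in [set x : At A | ple (val x) a]].
Proof.
have [Arep _ _] := hA; split; last by move=> _ [x _ <-]; exists x.
move=> c y z [y' ya] [yc <-] [z' za] [zc <-].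
have /class_of_eq yz : class_of y' = class_of z' by rewrite yc zc.
by apply: val_inj; exact: rep_sim_eq Arep _ ya za yz.
Qed.

Definition GF : algebra sigma := Gprime Fprime_closed.

Definition eta (a : A) : GF := exist _ _ (eta_section a).

End Fprime.

(* Main.v *)
From HB Require Import structures.
From mathcomp Require Import all_boot.
From mathcomp Require Import boolp classical_sets functions.
Require Import Defs.

(** A representation turns the order into inclusion of graphs, so an atom below
    a join is below one of the joinands, and in an atomic representable algebra
    every element is the join of the atoms below it.  The map [eta], which
    sends an element to the section given by these atoms, is therefore
    injective.  It respects

    - [-], because an atom below [a] is either below [b] or below [a - b];
    - [|>], because the classes of [sim] on atoms play the role of points of the
      domain: an atom lies below [a |> b] when it lies below [b] and is
      equivalent to an atom below [a] ([ple_atom_restr]);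
    - the operators, because complete additivity, used in one coordinate at a
      time, reduces the value of an operator at a tuple to its values at tuples
      of atoms ([ple_atom_operator]).

    On the other side, in the algebra of all sections of a surjection the joins
    are the unions ([is_join_sections]), and two sections are compatible when
    their union is again a section ([compatible_sections]).  Hence the union
    of pairwise compatible sections is their join, which is compatible
    completeness, and operators defined by relations commute with unions in each
    coordinate and preserve compatibility.  Finally, a section is the union of
    its singletons, and the singleton at an atom [x] is [eta x]; this is join
    density. *)

Set Implicit Arguments.
Unset Strict Implicit.
Unset Printing Implicit Defensive.

Local Open Scope classical_set_scope.

(** * Atoms in representable algebras *)

Lemma representableP (A : dr_algebra) : representable A ->
  exists (X Y : Type) (theta : A -> set (X * Y)),
    [/\ forall a, partial_function (theta a), injective theta,
        forall a b, theta (minus a b) = theta a `\` theta b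
      & forall a b, theta (restr a b) = pf_restr (theta a) (theta b)].
Proof.
move=> [X [Y [B [th [[_ Bpf _ _] [thB thI _] thM thR]]]]].
exists X, Y, th; split=> // [a|a b]; first exact/Bpf/thB.
by apply: thI; rewrite inE.
Qed.

Section Representable.
Context {A : dr_algebra} (repA : representable A).
Implicit Types (a b c x y : A) (S : set A).

Lemma ple_refl a : ple a a.
Proof.
have [X [Y [th [pf inj M R]]]] := representableP repA.
exact/(ple_rep inj M).
Qed.

Lemma ple_trans a b c : ple a b -> ple b c -> ple a c.
Proof.
have [X [Y [th [pf inj M R]]]] := representableP repA.
by move=> /(ple_rep inj M) ab /(ple_rep inj M) bc;
  apply/(ple_rep inj M) => p /ab/bc.
Qed.

Lemma ple_antisym a b : ple a b -> ple b a -> a = b.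
Proof.
have [X [Y [th [pf inj M R]]]] := representableP repA.
by move=> /(ple_rep inj M) ab /(ple_rep inj M) ba; apply/inj/seteqP.
Qed.

Lemma least_minus a b : least (minus a b) <-> ple a b.
Proof.
have [X [Y [th [pf inj M R]]]] := representableP repA.
split=> [/(least_rep inj M)|/(ple_rep inj M) ab].
  by rewrite M setD_eq0 => ab; apply/(ple_rep inj M).
by apply/(least_rep inj M); rewrite M setD_eq0.
Qed.

Lemma ple_atom_minus x a b :
  atom x -> ple x (minus a b) <-> ple x a /\ ~ ple x b.
Proof.
have [X [Y [th [pf inj M R]]]] := representableP repA.
have P := ple_rep inj M.
move=> [x0 xmin]; split=> [/P|[/P xa xb]].
  rewrite M => xab; split; first by apply/P => p /xab[].
  move=> /P xb; apply: x0; apply/(least_rep inj M).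
  by apply/seteqP; split=> // p xp; have [_ /(_ (xb _ xp))] := xab _ xp.
have <- : minus x b = x.
  apply: xmin; first by move=> /least_minus.
  by apply/P; rewrite M => p [].
by apply/P; rewrite !M => p [xp bp]; split=> //; exact: xa.
Qed.

(** If no joinand were above the atom [x], then [c - x] would still be an upper
    bound, contradicting the minimality of [c]. *)
Lemma ple_atom_join x S c :
  atom x -> is_join S c -> ple x c -> exists2 s, S s & ple x s.
Proof.
have [X [Y [th [pf inj M R]]]] := representableP repA.
have P := ple_rep inj M.
move=> ax [ub lub] xc; apply: contrapT => nS.
have /(ple_trans xc)/(ple_atom_minus _ _ ax) [_ []] : ple c (minus c x);
  last first.
  exact: ple_refl.
apply: lub => s Ss; apply/P; rewrite M => p sp; split.
  exact: (P _ _).1 (ub s Ss) _ sp.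
move=> xp; apply: nS; exists s => //; apply: contrapT => nxs.
have /P : ple x (minus x s).
  by apply/(ple_atom_minus _ _ ax); split; [exact: ple_refl|].
by rewrite M => /(_ _ xp)[].
Qed.

Lemma join_atoms a : atomic A -> is_join [set x | atom x /\ ple x a] a.
Proof.
move=> atA; split=> [x []//|b ub].
apply: contrapT => /least_minus/atA[x ax /(ple_atom_minus _ _ ax)[xa]].
by apply; exact: ub.
Qed.

(** The atom equivalent to [x] is found below [restr x a]: this element is
    nonzero because the domain of [x] is included in that of [a], and an atom
    whose domain meets that of the atom [x] has the same domain. *)
Lemma ple_atom_restr x a b : atomic A -> atom x ->
  ple x (restr a b) <-> ple x b /\ exists y, [/\ atom y, ple y a & sim y x].
Proof.
have [X [Y [th [pf inj M R]]]] := representableP repA.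
have P := ple_rep inj M; have D := preceq_rep inj M R.
move=> atA ax; split=> [/P|[/P xb [y [ay /P ya [_ /D xy]]]]]; last first.
  apply/P; rewrite R => -[u v] xuv; split; first exact: xb.
  have [w yw] : (th y).`1 u by apply: xy; exists v.
  by exists w; exact: ya.
rewrite R => xab; split; first by apply/P => p /xab[].
have : ~ least (restr x a).
  move=> /(least_rep inj M); rewrite R => xa0.
  apply: ax.1; apply/(least_rep inj M); apply/seteqP; split=> // -[u v] xuv.
  have [_ [w aw]] := xab _ xuv.
  suff : (set0 : set (X * Y)) (u, w) by [].
  by rewrite -xa0; split=> //; exists v.
move=> /atA[y ay /P]; rewrite R => yxa; exists y; split=> //.
  by apply/P => p /yxa[].
have [[u v] yuv] : exists p, th y p.
  apply: contrapT => y0; apply: ay.1; apply/(least_rep inj M).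
  by apply/seteqP; split=> // p yp; apply: y0; exists p.
have [_ xu] := yxa _ yuv.
by split; apply: (atom_restr inj M R (u := u)) => //; exists v.
Qed.

End Representable.

Lemma eq_atoms (A : dr_algebra) (a b : A) : representable A -> atomic A ->
  (forall x, atom x -> ple x a <-> ple x b) -> a = b.
Proof.
move=> repA atA ab; have [_ la] := join_atoms repA a atA.
have [_ lb] := join_atoms repA b atA.
by apply: ple_antisym => //; [apply: la|apply: lb] => x [ax /(ab _ ax)].
Qed.

(** * Completely additive operators on tuples *)

(** The hypothesis [b i = a i] lets the step at coordinate [i] use the original
    entry: the entries are replaced in increasing order of index. *)
Lemma replace_entries (T : Type) (n : nat) (a : 'I_n -> T)
    (R : 'I_n -> T -> Prop) (Q : ('I_n -> T) -> Prop) :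
  (forall i b, b i = a i -> Q b ->
     exists2 y, R i y & Q (dfwith b (i := i) y)) ->
  Q a -> exists2 b, (forall i, R i (b i)) & Q b.
Proof.
move=> step Qa.
have H k : exists b, [/\ forall i : 'I_n, i < k -> R i (b i),
    forall i : 'I_n, k <= i -> b i = a i & Q b].
  elim: k => [|k [b [Rb ba Qb]]]; first by exists a.
  have [kn|nk] := ltnP k n; last first.
    exists b; split=> // i ik; last exact/ba/ltnW.
    by apply: Rb; exact: leq_trans (ltn_ord i) nk.
  have [y Ry Qy] := step (Ordinal kn) b (ba (Ordinal kn) (leqnn k)) Qb.
  exists (dfwith b (i := Ordinal kn) y); split=> // i.
    rewrite ltnS leq_eqVlt; have [<- _|ne] := eqVneq (Ordinal kn) i.
      by rewrite dfwith_in.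
    rewrite dfwith_out //; have -> /= : (i == k :> nat) = false.
      by apply: contra_neqF ne => /eqP ik; apply: val_inj.
    exact: Rb.
  move=> ki; rewrite dfwith_out; first exact/ba/ltnW.
  by apply: contraTneq ki => <- /=; rewrite ltnn.
by have [b [Rb _ Qb]] := H n; exists b => // i; exact: Rb.
Qed.

Section Additive.
Context {A : dr_algebra} (repA : representable A).
Context {n : nat} {Omega : ('I_n -> A) -> A}.
Hypothesis Omega_add : completely_additive Omega.

Lemma dfwith_id (T : Type) (a : 'I_n -> T) i : dfwith a (i := i) (a i) = a.
Proof. by apply/funext => j; case: dfwithP. Qed.

(** Raising one entry from [c] to a larger [d] is the case of additivity at the
    join [d] of [c] and [d]. *)
Lemma completely_additive_homo (a b : 'I_n -> A) :
  (forall i, ple (a i) (b i)) -> ple (Omega a) (Omega b).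
Proof.
move=> ab; pose R i y := y = b i.
pose Q c := ple (Omega a) (Omega c).
have [i c ca ac||d /funext -> //] := @replace_entries _ _ a R Q.
  exists (b i) => //; apply: (ple_trans repA ac).
  have J : is_join [set c i; b i] (b i).
    split=> [x [->|->]|x ub]; [by rewrite ca|exact: ple_refl|].
    by apply: ub; right.
  have [ub _] := Omega_add J i c.
  by apply: ub; exists (c i); [left|rewrite dfwith_id].
exact: ple_refl.
Qed.

Lemma ple_atom_operator x (a : 'I_n -> A) : atomic A -> atom x ->
  ple x (Omega a) <->
  exists2 y : 'I_n -> A, (forall i, atom (y i) /\ ple (y i) (a i))
                       & ple x (Omega y).
Proof.
move=> atA ax; split=> [|[y ya xy]]; last first.
  apply: (ple_trans repA xy); apply: completely_additive_homo => i.
  by case: (ya i).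
apply: (replace_entries (R := fun i y => atom y /\ ple y (a i))
                        (Q := fun c => ple x (Omega c))) => i c ca xc.
have J := Omega_add (join_atoms repA (c i) atA) i c.
rewrite dfwith_id in J.
have [_ [y + <-] xy] := ple_atom_join repA ax J xc.
by exists y; rewrite // -ca.
Qed.

End Additive.

(** * The algebra of sections of a surjection *)

Section Sections.
Context {sigma : signature} {P : rel_surjection sigma}.
Context (closedP : sections_closed P).
Local Notation G := (Gprime closedP).
Implicit Types (f g c : G) (S : set G).

Lemma sval_section_inj : injective (fun f : G => sval f).
Proof. by move=> [f sf] [g sg] /= fg; exact: eq_exist. Qed.

Lemma ple_sections f g : ple f g <-> sval f `<=` sval g.
Proof. exact: (ple_rep sval_section_inj). Qed.

Lemma least_sections f : least f <-> sval f = set0.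
Proof. exact: (least_rep sval_section_inj). Qed.

Lemma sectionsE f p : sval f p -> p = (proj p.2, p.2).
Proof. by case: f => f [_ sf] /= /sf [x _ <-]. Qed.

Lemma im_section f x : (sval f).`2 x <-> sval f (proj x, x).
Proof.
by split=> [[y fy]|]; [have := sectionsE fy => -[<-]|exists (proj x)].
Qed.

Lemma compatible_sections f g :
  compatible f g <-> sections (sval f `|` sval g).
Proof.
have [fpf sf] := svalP f; have [gpf sg] := svalP g.
have H (h k : G) u v w : compatible h k ->
    sval h (u, v) -> sval k (u, w) -> v = w.
  move=> hk hv kw; have [hpf _] := svalP h; apply: (hpf u) => //.
  have : sval (restr h k) (u, w) by split=> //; exists v.
  by rewrite hk => -[].
split=> [fg|[pf _]].
  split; last by rewrite subUset.
  move=> u v w [fv|gv] [fw|gw];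
    [exact: fpf fv fw|exact: H fg fv gw| |exact: gpf gv gw].
  by symmetry; exact: H fg fw gv.
apply: sval_section_inj; apply/seteqP; split=> -[u v] /= [p1 [w p2]];
  have -> : v = w by apply: (pf u); [by [left|right]|by [left|right]].
- by split=> //; exists v.
- by split=> //; exists v.
Qed.

Lemma sections_bigcup S : (forall f g, S f -> S g -> compatible f g) ->
  sections (\bigcup_(f in S) sval f).
Proof.
move=> cS; split=> [u v w [f Sf fv] [g Sg gw]|p [f Sf fp]].
  have /compatible_sections[pf _] := cS _ _ Sf Sg.
  by apply: (pf u); [left|right].
by have [_] := svalP f; exact.
Qed.

Lemma is_join_bigcup S c :
  sval c = \bigcup_(f in S) sval f -> is_join S c.
Proof.
move=> cE; split=> [f Sf|g ub]; apply/ple_sections; rewrite cE.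
  exact: bigcup_sup.
by apply: bigcup_sub => f /ub/ple_sections.
Qed.

(** The members of a set with an upper bound are pairwise compatible, so their
    union is a section, hence the least upper bound. *)
Lemma is_join_sections S c :
  is_join S c <-> sval c = \bigcup_(f in S) sval f.
Proof.
split=> [[ub lub]|]; last exact: is_join_bigcup.
have cS f g : S f -> S g -> compatible f g.
  move=> /ub/ple_sections fc /ub/ple_sections gc.
  apply/compatible_sections; have [cpf sc] := svalP c.
  split; first by move=> u v w [/fc|/gc] cv [/fc|/gc]; exact: cpf cv.
  by move=> p [/fc|/gc]; exact: sc.
pose u : G := exist _ _ (sections_bigcup cS).
have [ubu _] : is_join S u by exact: is_join_bigcup.
apply/seteqP; split; first exact: (ple_sections c u).1 (lub u ubu).
by apply: bigcup_sub => f /ub/ple_sections.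
Qed.

Lemma Gprime_compatibly_complete : compatibly_complete G.
Proof.
move=> S /sections_bigcup cS; exists (exist _ _ cS : G).
exact: is_join_bigcup.
Qed.

Lemma Gprime_representable : representable G.
Proof.
exists (base P), (total P), (@sections _ P), (fun f : G => sval f); split=> //.
  split; [|by move=> f []|..].
  - by exists set0; split=> // x y z [].
  - by move=> f g sf _; exact: sections_minus.
  - by move=> f g _; exact: sections_restr.
split=> [f _|f g _ _|f sf]; [exact: svalP|exact: sval_section_inj|].
by exists (exist _ f sf).
Qed.

Lemma section_singleton (x : total P) : sections [set (proj x, x)].
Proof. by split=> [u v w [_ ->] [_ ->]//|_ ->]; exists x. Qed.

Lemma Gprime_atomic : atomic G.
Proof.
move=> f f0.
have [p fp] : exists p, sval f p.
  apply: contrapT => n; apply: f0; apply/least_sections.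
  by apply/seteqP; split=> // p fp; apply: n; exists p.
pose s : G := exist _ _ (section_singleton p.2).
exists s; last by apply/ple_sections => _ ->; rewrite -(sectionsE fp).
split=> [/least_sections/seteqP[+ _]|g g0 /ple_sections gs]; first exact.
apply: sval_section_inj; apply/seteqP; split=> //= _ ->.
apply: contrapT => ng; apply: g0; apply/least_sections.
by apply/seteqP; split=> // q gq; apply: ng; rewrite -(gs _ gq).
Qed.

(** Both values are contained in the value at the unions of the arguments, and
    this value is a section. *)
Lemma Gprime_compatibility_preserving (s : sigma) :
  compatibility_preserving (interp (a := G) (s := s)).
Proof.
move=> f g fg; apply/compatible_sections.
have /closedP[pf _] i : sections (sval (f i) `|` sval (g i)).
  exact/compatible_sections.
have fS : sval (interp f) `<=`
    Omega_rel (s := s) (fun i => sval (f i) `|` sval (g i)).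
  move=> _ [x [xs fx Rx] <-]; exists x => //; exists xs => // i.
  by have [u fu] := fx i; exists u; left.
have gS : sval (interp g) `<=`
    Omega_rel (s := s) (fun i => sval (f i) `|` sval (g i)).
  move=> _ [x [xs gx Rx] <-]; exists x => //; exists xs => // i.
  by have [u gu] := gx i; exists u; right.
split; first by move=> u v w [/fS|/gS] hv [/fS|/gS]; exact: pf hv.
have [_ sf] := svalP (interp f); have [_ sg] := svalP (interp g).
by rewrite subUset.
Qed.

Lemma Gprime_completely_additive (s : sigma) :
  completely_additive (interp (a := G) (s := s)).
Proof.
move=> S c /is_join_sections cE i a; apply/is_join_sections/seteqP; split.
  move=> _ [x [xs ax Rx] <-].
  have := ax i; rewrite dfwith_in cE => -[u [f Sf fu]].
  exists (interp (dfwith a (i := i) f)); first by exists f.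
  exists x => //; exists xs => // j; have := ax j.
  have [<- _|ij] := eqVneq i j; last by rewrite !dfwith_out.
  by rewrite dfwith_in; exists u.
move=> _ [_ [f Sf <-] [x [xs ax Rx] <-]]; exists x => //; exists xs => // j.
have := ax j; have [<-|ij] := eqVneq i j; last by rewrite !dfwith_out.
by rewrite !dfwith_in cE => -[u fu]; exists u; exists f.
Qed.

Lemma Gprime_AtRepAlg : AtRepAlg G.
Proof.
split; [exact: Gprime_representable|exact: Gprime_atomic|move=> s; split].
- exact: Gprime_compatibility_preserving.
- exact: Gprime_completely_additive.
Qed.

End Sections.

(** * The embedding of an algebra in the sections over its atoms *)

Section Eta.
Context {sigma : signature} {A : algebra sigma} (hA : AtRepAlg A).

Lemma eta_mem (a : A) (x : At A) :
  sval (eta hA a) (class_of x, x) <-> ple (val x) a.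
Proof. by split=> [[y ya [_ <-]]|xa] //; exists x. Qed.

Lemma eq_sections (f g : GF hA) :
  (forall x : At A, sval f (class_of x, x) <-> sval g (class_of x, x)) -> f = g.
Proof.
move=> fg; apply: sval_section_inj; apply/seteqP.
by split=> p fp; move: (fp); rewrite (sectionsE fp) => /fg.
Qed.

Lemma eta_injective : injective (eta hA).
Proof.
have [repA atA _] := hA.
move=> a b ab; apply: eq_atoms => // x /mem_set ax.
by rewrite -!(eta_mem _ (exist _ x ax)) ab.
Qed.

Lemma eta_homomorphism : homomorphism (eta hA).
Proof.
have [repA atA opA] := hA.
have atP (x : At A) : atom (val x) by exact: set_mem (valP x).
split=> [a b|a b|s a]; apply: eq_sections => x.
- rewrite eta_mem (ple_atom_minus repA) //.
  by split=> [[/eta_mem xa xb]|[/eta_mem xa xb]]; split=> // /eta_mem.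
- rewrite eta_mem (ple_atom_restr repA) //; split.
    move=> [xb [y [/mem_set ay ya yx]]]; split; first exact/eta_mem.
    exists (exist _ y ay); exists (exist _ y ay) => //=.
    by congr pair; apply/(class_of_eq hA).
  move=> [/eta_mem xb [z [y ya yx]]]; split=> //.
  exists (val y); split=> //; apply/(class_of_eq hA).
  exact: (congr1 (fun p => p.1) yx).
- rewrite eta_mem (ple_atom_operator repA (opA s).2) //; split.
    move=> [y ya xy].
    exists x => //; exists (fun i => exist _ (y i) (mem_set (ya i).1)) => // i.
    by apply/im_section/eta_mem; exact: (ya i).2.
  move=> [z [ys ya xy] [_ zx]]; rewrite zx in xy.
  exists (fun i => val (ys i)) => // i.
  by split=> //; apply/eta_mem; exact: (im_section (eta hA (a i)) (ys i)).1.
Qed.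

Lemma eta_atom (x : At A) : sval (eta hA (val x)) = [set (class_of x, x)].
Proof.
apply/seteqP; split=> [_ [y /= yx <-]|_ ->]; last first.
  by apply/eta_mem; apply: ple_refl; case: hA.
have [y0 _] : atom (val y) by exact: set_mem (valP y).
have [_ xmin] : atom (val x) by exact: set_mem (valP x).
by rewrite (val_inj (xmin _ y0 yx)).
Qed.

Lemma eta_join_dense : join_dense (range (eta hA)).
Proof.
move=> f.
exists [set eta hA (val x) | x in [set x : At A | sval f (class_of x, x)]].
  by move=> _ [x _ <-]; exists (val x).
apply/is_join_sections; rewrite bigcup_image.
apply/seteqP; split=> [p fp|p [x fx]]; last by rewrite eta_atom => ->.
exists p.2; first by rewrite /= -(sectionsE fp).
by rewrite eta_atom; exact: sectionsE fp.
Qed.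

End Eta.

Theorem corollary5p14 (sigma : signature) (A : algebra sigma)
    (hA : AtRepAlg A) :
  compatible_completion (eta hA).
Proof.
split.
- by split; [exact: eta_homomorphism|exact: eta_injective].
- exact: Gprime_AtRepAlg.
- exact: Gprime_compatibly_complete.
- exact: eta_join_dense.
Qed.
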